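(* Let $L>0$. There exist constants $c_1,c_2,c_3>0$ (depending only on $L$) such that the following holds. Let $n\ge 2$, $m\ge 1$ be integers, let $s\in[1,n]$, and let $A\in\mathbb{R}^{m\times n}$ be a random matrix whose rows are i.i.d. isotropic and subgaussian random vectors in $\mathbb{R}^n$ with subgaussian constant $L$. Then for any $\epsilon>0$ such that $$m\ge c_1\frac{s\log n}{\epsilon^2},$$ we have $$\mathbb{E}\,\bigl|1-\rho_s(A/\sqrt{m})\bigr|\le c_2\,\epsilon$$ and $$\mathbb{P}\bigl\{1-\epsilon\le\rho_s(A/\sqrt{m})\le 1+\epsilon\bigr\}\ge 1-\exp(-c_3\,\epsilon^2 m).$$
   Context: For a scalar random variable $X$, the Orlicz $\psi_2$ norm is $\|X\|_{\psi_2}=\inf\{t>0:\mathbb{E}\exp(|X|^2/t^2)\le 2\}$. A random vector $\boldsymbol{X}\in\mathbb{R}^n$ is called isotropic and subgaussian (with constant $L$) if $\mathbb{E}|\langle\boldsymbol{X},\boldsymbol{u}\rangle|^2=\|\boldsymbol{u}\|_2^2$ and $\|\langle\boldsymbol{X},\boldsymbol{u}\rangle\|_{\psi_2}\le L\|\boldsymbol{u}\|_2$ for every $\boldsymbol{u}\in\mathbb{R}^n$. The $\ell_1$-sparsity level of a non-zero vector $\boldsymbol{x}\in\mathbb{R}^n$ is $s(\boldsymbol{x})=\|\boldsymbol{x}\|_1^2/\|\boldsymbol{x}\|_2^2$. For $s\in[1,n]$ and a matrix $B\in\mathbb{R}^{m\times n}$, the $\ell_1$-constrained minimal singular value of $B$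 is $$\rho_s(B)=\min_{\boldsymbol{x}\ne 0,\ s(\boldsymbol{x})\le s}\frac{\|B\boldsymbol{x}\|_2}{\|\boldsymbol{x}\|_2}.$$ *)

(* Defs.v *)
From HB Require Import structures.
From mathcomp Require Import all_boot all_order all_algebra.
From mathcomp Require Import all_classical all_reals all_analysis.
Set Implicit Arguments.
Unset Strict Implicit.
Unset Printing Implicit Defensive.
Import Order.TTheory GRing.Theory Num.Theory.
Import numFieldNormedType.Exports.

Local Open Scope classical_set_scope.
Local Open Scope ring_scope.

(* The norm `|x| that the library puts on matrices is the sup norm, hence the
   explicit l1 and l2 norms. *)
Definition norm1 (R : realType) (n : nat) (x : 'cV[R]_n) : R :=
  \sum_(i < n) `|x i ord0|.

Definition norm2 (R : realType) (n : nat) (x : 'cV[R]_n) : R :=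
  Num.sqrt (\sum_(i < n) x i ord0 ^+ 2).

Definition l1_sparsity (R : realType) (n : nat) (x : 'cV[R]_n) : R :=
  norm1 x ^+ 2 / norm2 x ^+ 2.

(* For 1 <= n and 1 <= s this infimum is a minimum: the quotient and the
   sparsity level are invariant under scaling, so that it suffices to let x
   range over a compact subset of the unit sphere, which contains the vectors
   of the canonical basis (lemma [rho_is_min]). *)
Definition rho (R : realType) (m n : nat) (s : R) (B : 'M[R]_(m, n)) : R :=
  inf [set norm2 (B *m x) / norm2 x | x in
        [set x : 'cV[R]_n | x != 0 /\ l1_sparsity x <= s]].

Lemma rho_is_min (R : realType) (m n : nat) (s : R) (B : 'M[R]_(m, n)) :
  (1 <= n)%N -> 1 <= s ->
  exists x : 'cV[R]_n, [/\ x != 0, l1_sparsity x <= s,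
    rho s B = norm2 (B *m x) / norm2 x &
    forall y : 'cV[R]_n, y != 0 -> l1_sparsity y <= s ->
      rho s B <= norm2 (B *m y) / norm2 y].
Proof.
case: n B => // n B _ s1.
pose N1 (v : 'rV[R]_n.+1) := norm1 v^T; pose N2 (v : 'rV[R]_n.+1) := norm2 v^T.
pose f (v : 'rV[R]_n.+1) := norm2 (B *m v^T).
pose K := [set v : 'rV[R]_n.+1 | N2 v = 1 /\ N1 v <= Num.sqrt s].
have s0 : 0 <= s by rewrite (le_trans _ s1).
have n2ge0 k (x : 'cV[R]_k) : 0 <= norm2 x by exact: sqrtr_ge0.
have n1ge0 k (x : 'cV[R]_k) : 0 <= norm1 x by exact: sumr_ge0.
have n2Z k a (x : 'cV[R]_k) : norm2 (a *: x) = `|a| * norm2 x.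
  rewrite /norm2 -sqrtr_sqr -sqrtrM ?sqr_ge0// mulr_sumr.
  by congr Num.sqrt; apply: eq_bigr => i _; rewrite mxE exprMn.
have n1Z k a (x : 'cV[R]_k) : norm1 (a *: x) = `|a| * norm1 x.
  by rewrite /norm1 mulr_sumr; apply: eq_bigr => i _; rewrite mxE normrM.
have n2gt0 k (x : 'cV[R]_k) : x != 0 -> 0 < norm2 x.
  move=> x0; rewrite sqrtr_gt0 lt_neqAle sumr_ge0 ?andbT; last first.
    by move=> i _; rewrite sqr_ge0.
  apply: contra x0; rewrite eq_sym psumr_eq0; last first.
    by move=> i _; rewrite sqr_ge0.
  move=> /allP h; apply/eqP/colP => i; rewrite mxE; apply/eqP.
  by rewrite -sqrf_eq0; apply: (implyP (h i _)) => //; exact: mem_index_enum.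
have csum k (g : 'I_k -> 'rV[R]_n.+1 -> R) : (forall i, continuous (g i)) ->
    continuous (fun v => \sum_(i < k) g i v).
  by move=> cg; apply: continuous_big => //; exact: add_continuous.
have cN2 k (g : 'rV[R]_n.+1 -> 'cV[R]_k) :
    (forall i, continuous (fun v => g v i ord0)) ->
    continuous (fun v => norm2 (g v)).
  move=> cg v; rewrite /norm2.
  apply: (@continuous_comp _ _ _
    (fun w => \sum_(i < k) g w i ord0 ^+ 2) Num.sqrt); last first.
    exact: sqrt_continuous.
  apply: csum => i {}v; exact: (cvgM (cg i v) (cg i v)).
have cT i : continuous (fun v : 'rV[R]_n.+1 => v^T i ord0).
  by under eq_fun do rewrite mxE; exact: coord_continuous.
have cN1 : continuous N1.
  by apply: csum => i v; exact: (cvg_norm (cT i v)).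
have cf : continuous f.
  apply: cN2 => i; under eq_fun do rewrite mxE.
  by apply: csum => j v; exact: (cvgMl_tmp (cT j v)).
have cK : compact K.
  apply: bounded_closed_compact.
    exists 1; split; first exact: num_real.
    move=> x x1 v [v1 _]; apply: (le_trans _ (ltW x1)).
    rewrite /Num.norm/= mx_normrE; apply: bigmax_le => // -[i j] _ /=.
    rewrite (ord1 i) -(@ler_pXn2r _ 2) ?nnegrE// real_normK ?num_real//.
    rewrite -v1 sqr_sqrtr; last by apply: sumr_ge0 => *; rewrite sqr_ge0.
    rewrite (bigD1 j)//= mxE lerDl sumr_ge0// => k _; exact: sqr_ge0.
  have -> : K = (N2 @^-1` [set 1]) `&` (N1 @^-1` [set x | x <= Num.sqrt s]) by [].
  apply: closedI; apply: preimage_closed.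
  - by move=> v _; exact: cN2.
  - exact: closed_eq.
  - by move=> v _; exact: cN1.
  - exact: closed_le.
have K0 : K !=set0.
  exists (delta_mx ord0 ord0); rewrite /K/= /N1 /N2 /norm1 /norm2; split.
    rewrite (bigD1 ord0)//= big1 ?addr0; first by rewrite !mxE/= expr1n sqrtr1.
    by move=> i i0; rewrite !mxE/= (negbTE i0) expr0n.
  rewrite (bigD1 ord0)//= big1 ?addr0; last first.
    by move=> i i0; rewrite !mxE/= (negbTE i0) normr0.
  by rewrite !mxE/= normr1 -sqrtr1 ler_sqrt // (lt_le_trans ltr01).
have [c] := EVT_min_rV K0 cK (continuous_subspaceT cf).
rewrite inE => -[c1 cs] cmin.
have cn0 : c^T != 0.
  apply/eqP => c0; have : N2 c = 0.
    by rewrite /N2 c0 -(scale0r 0) n2Z normr0 mul0r.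
  by rewrite c1 => /eqP; rewrite oner_eq0.
have cS : l1_sparsity c^T <= s.
  rewrite /l1_sparsity -/(N2 c) c1 expr1n divr1 -(sqr_sqrtr s0).
  by rewrite ler_sqr ?nnegrE ?sqrtr_ge0 //; exact: n1ge0.
have lb y : y != 0 -> l1_sparsity y <= s -> f c <= norm2 (B *m y) / norm2 y.
  move=> y0 ys; have ny := n2gt0 _ _ y0.
  have := cmin ((norm2 y)^-1 *: y)^T; rewrite inE /K /f /N1 /N2/= !trmxK.
  rewrite -scalemxAr !n2Z n1Z ger0_norm ?invr_ge0// mulVf ?gt_eqF//.
  rewrite [norm2 (B *m y) / _]mulrC; apply; split => //.
  rewrite -[leLHS]ger0_norm ?mulr_ge0 ?invr_ge0// -sqrtr_sqr ler_wsqrtr//.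
  by rewrite exprMn exprVn mulrC.
have rhoE : rho s B = f c.
  have E0 : lbound [set norm2 (B *m x) / norm2 x | x in
      [set x : 'cV[R]_n.+1 | x != 0 /\ l1_sparsity x <= s]] (f c).
    by move=> _ [y [y0 ys] <-]; exact: lb.
  have Ec : [set norm2 (B *m x) / norm2 x | x in
      [set x : 'cV[R]_n.+1 | x != 0 /\ l1_sparsity x <= s]] (f c).
    by exists c^T => //; rewrite -/(N2 c) c1 divr1.
  apply/eqP; rewrite eq_le; apply/andP; split.
    by apply: ge_inf => //; exists (f c).
  by apply: lb_le_inf => //; exists (f c).
exists c^T; split => //; first by rewrite rhoE -/(N2 c) c1 divr1.
by move=> y y0 ys; rewrite rhoE; exact: lb.
Qed.

(* R^n, as row vectors, with its Borel sigma-algebra. *)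
Definition borel_rV (R : realType) (n : nat) :=
  g_sigma_algebraType (@open 'rV[R]_n).

Definition random_vector (R : realType) (d : measure_display)
    (T : measurableType d) (n : nat) (X : T -> 'rV[R]_n) : Prop :=
  measurable_fun [set: T] (X : T -> borel_rV R n).

Definition inner (R : realType) (n : nat) (x : 'rV[R]_n) (u : 'cV[R]_n) : R :=
  (x *m u) ord0 ord0.

(* Extended-real valued: +oo when no t is admissible. *)
Definition psi2_norm (R : realType) (d : measure_display)
    (T : measurableType d) (P : probability T R) (X : T -> R) : \bar R :=
  ereal_inf [set t%:E | t in [set t : R | 0 < t /\
    ('E_P[(fun w => (expR (`|X w| ^+ 2 / t ^+ 2))%R)] <= 2%:E)%E]].

Definition isotropic (R : realType) (d : measure_display)
    (T : measurableType d) (P : probability T R) (n : nat)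
    (X : T -> 'rV[R]_n) : Prop :=
  forall u : 'cV[R]_n,
    ('E_P[(fun w => (`|inner (X w) u| ^+ 2)%R)])%E = (norm2 u ^+ 2)%:E.

Definition subgaussian (R : realType) (d : measure_display)
    (T : measurableType d) (P : probability T R) (n : nat) (L : R)
    (X : T -> 'rV[R]_n) : Prop :=
  forall u : 'cV[R]_n,
    (psi2_norm P (fun w => inner (X w) u) <= (L * norm2 u)%:E)%E.

Definition mutually_independent (R : realType) (d : measure_display)
    (T : measurableType d) (P : probability T R) (I : finType) (n : nat)
    (X : I -> T -> 'rV[R]_n) : Prop :=
  forall (J : {set I}) (B : I -> set (borel_rV R n)),
    (forall i, i \in J -> measurable (B i)) ->
    P (\bigcap_(i in [set` J]) (X i @^-1` B i)) =
    (\prod_(i in J) P (X i @^-1` B i))%E.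

Definition identically_distributed (R : realType) (d : measure_display)
    (T : measurableType d) (P : probability T R) (I : Type) (n : nat)
    (X : I -> T -> 'rV[R]_n) : Prop :=
  forall (i j : I) (B : set (borel_rV R n)),
    measurable B -> P (X i @^-1` B) = P (X j @^-1` B).

(* Main.v *)
Require Import Defs.
From HB Require Import structures.
From mathcomp Require Import all_boot all_order all_algebra.
From mathcomp Require Import all_classical all_reals all_analysis.
From mathcomp Require Import measurable_realfun ring lra.
Set Implicit Arguments.
Unset Strict Implicit.
Unset Printing Implicit Defensive.
Import Order.TTheory GRing.Theory Num.Theory.
Import numFieldNormedType.Exports.
Local Open Scope classical_set_scope.
Local Open Scope ring_scope.

(* For a fixed vector z, |B z|^2 / |z|^2 with B = A / sqrt m is a mean of m
   independent variables of expectation 1 with a uniform exponential moment, so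
   a Bernstein inequality controls its deviation from 1.  A union bound extends
   this to the integer vectors z with l1 norm at most 6 s; there are at most
   (2 n + 1)^(6 s) of them, which m >= c1 s log n / eps^2 absorbs.  To pass to
   an arbitrary x with |x|_2 = 1 and |x|_1 <= sqrt s, consider the bilinear form
   b of 1 - B^T B: being linear in each argument, b (y, y) for y = sqrt s x does
   not decrease when one argument after the other is replaced by a well chosen
   integer rounding of y, and polarization bounds b (z, z') for two roundings by
   the values of the quadratic form at the integer vectors z + z' and z - z'.
   This gives the lower bound on rho; a vector of the canonical basis gives the
   upper bound.  Since the condition on m also holds for k eps, k >= 1, summing
   the tail bounds over k gives the bound on the expectation. *)

(** * Integer rounding and quadratic forms *)

(** Linear programming duality: a set [S] of largest weight is optimal among fractional choices, and
    [tau] is the multiplier of the cardinality constraint that certifies it. *)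
Lemma best_subset (R : realType) (n k : nat) (a r : 'I_n -> R) :
  (forall i, 0 <= r i <= 1) -> \sum_i r i <= k%:R ->
  exists2 S : {set 'I_n}, (#|S| <= k)%N &
    \sum_i a i * r i <= \sum_(i in S) a i.
Proof.
move=> r01 rk.
have k0 : (#|@finset.set0 'I_n| <= k)%N by rewrite cards0.
have [S Sk Smax] := @arg_maxP _ _ _ finset.set0
  [pred S : {set 'I_n} | (#|S| <= k)%N] (fun S => \sum_(i in S) a i) k0.
rewrite /= in Sk Smax.
exists S => //.
have outin i j : i \in S -> j \notin S -> a j <= a i.
  move=> iS jS; have := Smax (j |: (S :\ i)).
  have jSi : j \notin S :\ i by rewrite !inE (negbTE jS) andbF.
  have -> : (#|j |: S :\ i| <= k)%N by rewrite cardsU1 jSi (leq_trans _ Sk)// (cardsD1 i S) iS.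
  move=> /(_ isT); rewrite big_setU1//= (big_setD1 i iS)/=.
  by rewrite lerD2r.
have in0 i : i \in S -> 0 <= a i.
  move=> iS; have := Smax (S :\ i).
  have -> : (#|S :\ i| <= k)%N.
    by rewrite (leq_trans _ Sk)// (cardsD1 i S) iS.
  by move=> /(_ isT); rewrite (big_setD1 i iS)/= lerDr.
have out0 j : j \notin S -> (#|S| < k)%N -> a j <= 0.
  move=> jS Sk'; have := Smax (j |: S).
  by rewrite cardsU1 jS => /(_ Sk'); rewrite big_setU1//= gerDr.
pose tau := \big[Num.max/0]_(j | j \notin S) a j.
have tau0 : 0 <= tau by apply: bigmax_ge_id.
have tauS i : i \in S -> tau <= a i.
  by move=> iS; apply: bigmax_le; [exact: in0|move=> j; exact: outin].
have tauN i : i \notin S -> a i <= tau.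
  by move=> iS; apply: (le_bigmax_cond 0 a).
(* Complementary slackness: a set with fewer than [k] elements leaves out only nonpositive values,
   so [tau] is the default 0. *)
have tauk : tau * (k%:R - #|S|%:R) = 0.
  have [Sk'|] := ltnP #|S| k.
    suff -> : tau = 0 by rewrite mul0r.
    apply/eqP; rewrite eq_le tau0 andbT; apply: bigmax_le => // j jS.
    exact: out0.
  by move=> kS; have -> : #|S| = k by [apply/eqP; rewrite eqn_leq Sk kS];
    rewrite subrr mulr0.
have : \sum_i (a i - tau) * r i <= \sum_(i in S) (a i - tau).
  rewrite [leLHS](bigID (mem S))/= -[leRHS]addr0 lerD//.
    apply: ler_sum => i iS; have /andP[r0 r1] := r01 i.
    by rewrite ler_piMr// subr_ge0 tauS.
  apply: sumr_le0 => i iS; have /andP[r0 r1] := r01 i.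
  by rewrite mulr_le0_ge0// subr_le0 tauN.
rewrite sumrB sumr_const.
under eq_bigr do rewrite mulrBl; rewrite sumrB -mulr_sumr -mulr_natr.
have := ler_wpM2l tau0 rk; lra.
Qed.

(** Integer vectors are encoded by lists of signed unit steps, [true] meaning a minus sign: addition
    becomes concatenation, and counting vectors reduces to counting lists. *)
Definition signed_sum (R : realType) (n : nat) (l : seq ('I_n * bool)) :
    'cV[R]_n :=
  \sum_(p <- l) (-1) ^+ p.2 *: delta_mx p.1 ord0.

Lemma norm2_sqr (R : realType) n (x : 'cV[R]_n) :
  norm2 x ^+ 2 = \sum_i x i ord0 ^+ 2.
Proof. by rewrite sqr_sqrtr// sumr_ge0// => i _; rewrite sqr_ge0. Qed.

Lemma signed_sum_cat (R : realType) n (l l' : seq ('I_n * bool)) :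
  signed_sum R (l ++ l') = signed_sum R l + signed_sum R l'.
Proof. by rewrite /signed_sum big_cat. Qed.

Lemma signed_sum_opp (R : realType) n (l : seq ('I_n * bool)) :
  signed_sum R [seq (p.1, ~~ p.2) | p <- l] = - signed_sum R l.
Proof.
rewrite /signed_sum big_map -sumrN; apply: eq_bigr => -[i b] _ /=.
by rewrite -scaleNr; congr (_ *: _); case: b; rewrite /= ?expr0 ?expr1 ?opprK.
Qed.

Lemma signed_sumE (R : realType) n (l : seq ('I_n * bool)) i :
  signed_sum R l i ord0 = \sum_(p <- l | p.1 == i) (-1) ^+ p.2.
Proof.
rewrite /signed_sum summxE big_mkcond [RHS]big_mkcond/=; apply: eq_bigr => p _.
by rewrite !mxE andbT eq_sym; case: eqP => _; rewrite ?mulr1 ?mulr0.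
Qed.

(* The integer parts of |y i| are kept; the fractional parts, a point of a
   polytope with 0/1 vertices, are replaced by the best vertex for a. *)
Lemma sparse_rounding (R : realType) (n : nat) (s : R) (a y : 'I_n -> R) :
  1 <= s -> \sum_i `|y i| <= s -> \sum_i y i ^+ 2 <= s ->
  exists l : seq ('I_n * bool), [/\ (size l)%:R <= 3 * s,
    norm2 (signed_sum R l) ^+ 2 <= 6 * s &
    \sum_i a i * y i <= \sum_i a i * signed_sum R l i ord0].
Proof.
move=> s1 y1 y2.
pose g i : nat := Num.truncn `|y i|.
pose r i := `|y i| - (g i)%:R.
pose sg i : bool := y i < 0.
have gy i : (g i)%:R <= `|y i| < (g i)%:R + 1.
  by rewrite natr1; exact: (truncn_itv (normr_ge0 _)).
have r01 i : 0 <= r i <= 1.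
  by have /andP[? ?] := gy i; rewrite /r; apply/andP; split; lra.
have s0 : 0 <= s by lra.
have /andP[sN1 sN2] : (Num.truncn s)%:R <= s < (Num.truncn s)%:R + 1.
  by rewrite natr1; exact: (truncn_itv s0).
have rk : \sum_i r i <= (Num.truncn s).+1%:R.
  rewrite -natr1 (le_trans _ (ltW sN2))// (le_trans _ y1)//.
  by apply: ler_sum => i _; rewrite /r gerBl.
have [S Sk Smax] := best_subset (fun i => (-1) ^+ sg i * a i) r01 rk.
have Sk' : #|S|%:R <= s + 1.
  by apply: (@le_trans _ _ (Num.truncn s).+1%:R); [rewrite ler_nat|rewrite -natr1; lra].
(* Index [i] occurs [g i] times, and once more if it is in [S], always with the sign of [y i]. As
   [1 <= s], the length is at most [s + (s + 1) <= 3 s], and the squared norm at most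
   [2 s + 2 (s + 1) <= 6 s]. *)
pose l := flatten [seq nseq (g i) (i, sg i) | i <- enum 'I_n] ++
  [seq (i, sg i) | i <- enum S].
have lE i : signed_sum R l i ord0 = (-1) ^+ sg i * ((g i)%:R + (i \in S)%:R).
  rewrite /l signed_sum_cat mxE mulrDr !signed_sumE; congr (_ + _).
    rewrite big_flatten big_map/= big_enum/= (bigD1 i)//= big_nseq_cond eqxx/=.
    rewrite iter_addr_0 mulr_natr big1 ?addr0// => j ji.
    by rewrite big_nseq_cond/= (negbTE ji).
  rewrite big_map big_enum_cond/=.
  have [iS|iS] := boolP (i \in S).
    rewrite (bigD1 i) ?iS ?eqxx//= big1 ?addr0 ?mulr1//.
    by move=> j /andP[/andP[_ /eqP ->]]; rewrite eqxx.
  by rewrite mulr0 big1// => j /andP[jS /eqP ji]; rewrite -ji jS in iS.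
have gs : \sum_i (g i)%:R <= s.
  by apply: le_trans y1; apply: ler_sum => i _; have /andP[] := gy i.
have yE i : y i = (-1) ^+ sg i * `|y i| by rewrite /sg -numEsign.
exists l; split.
- rewrite size_cat size_flatten /shape -map_comp size_map -cardE natrD.
  rewrite sumnE big_map big_enum/= natr_sum.
  by under eq_bigr do rewrite size_nseq; lra.
- rewrite norm2_sqr.
  apply: (@le_trans _ _ (\sum_i (2 * y i ^+ 2 + 2 * (i \in S)%:R))).
    apply: ler_sum => i _; rewrite lE exprMn sqrr_sign mul1r.
    rewrite -(real_normK (num_real (y i))).
    have /andP[g1 _] := gy i; have g0 : 0 <= (g i)%:R :> R by [].
    have : (g i)%:R ^+ 2 <= `|y i| ^+ 2 by rewrite ler_sqr ?nnegrE.
    have := sqr_ge0 ((g i)%:R - 1 : R).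
    by case: (i \in S); rewrite /=; nra.
  rewrite big_split/= -!mulr_sumr -natr_sum.
  have -> : (\sum_i (i \in S) = #|S|)%N by rewrite -sum1_card [RHS]big_mkcond.
  lra.
- have -> : \sum_i a i * signed_sum R l i ord0 =
     \sum_i (-1) ^+ sg i * a i * (g i)%:R + \sum_(i in S) (-1) ^+ sg i * a i.
    rewrite [X in _ + X]big_mkcond -big_split/=; apply: eq_bigr => i _.
    rewrite lE; move: ((-1) ^+ sg i) => e.
    by case: (i \in S); rewrite /=; ring.
  rewrite -lerBlDl (le_trans _ Smax)// -sumrB.
  rewrite le_eqVlt; apply/orP; left; apply/eqP; apply: eq_bigr => i _.
  by rewrite {1}yE /r; move: ((-1) ^+ sg i) => e; ring.
Qed.

(** For two roundings [z] and [z'] of [sqrt s x], polarization and the parallelogram law give [s b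
    (x, x) <= b (z, z') <= delta (|z|^2 + |z'|^2) / 2 <= 6 s delta]. *)
Lemma quadratic_sparse_bound (R : realType) (n : nat) (s delta : R)
    (M : 'M[R]_n) (x : 'cV[R]_n) :
  M^T = M -> 1 <= s -> 0 <= delta ->
  (forall l : seq ('I_n * bool), (size l)%:R <= 6 * s ->
    `|((signed_sum R l)^T *m M *m signed_sum R l) ord0 ord0|
      <= delta * norm2 (signed_sum R l) ^+ 2) ->
  norm2 x = 1 -> norm1 x <= Num.sqrt s ->
  (x^T *m M *m x) ord0 ord0 <= 6 * delta.
Proof.
move=> MT s1 d0 hM x2 x1.
have s0 : 0 < s by lra.
pose b (u v : 'cV[R]_n) := (u^T *m M *m v) ord0 ord0.
have bC u v : b u v = b v u.
  have vMu : v^T *m M *m u = (u^T *m M *m v)^T.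
    by rewrite !trmx_mul trmxK MT mulmxA.
  by rewrite /b vMu [RHS]mxE.
have bE u v : b u v = \sum_i (u^T *m M) ord0 i * v i ord0 by rewrite /b mxE.
pose y := Num.sqrt s *: x.
have yr u : exists l : seq ('I_n * bool), [/\ (size l)%:R <= 3 * s,
    norm2 (signed_sum R l) ^+ 2 <= 6 * s & b u y <= b u (signed_sum R l)].
  have [||l [l1 l2 l3]] := @sparse_rounding R n s (fun i => (u^T *m M) ord0 i)
      (fun i => y i ord0) s1.
  - rewrite /y; under eq_bigr do rewrite mxE normrM.
    rewrite -mulr_sumr ger0_norm ?sqrtr_ge0// -[leRHS](sqr_sqrtr (ltW s0)).
    by rewrite ler_wpM2l ?sqrtr_ge0.
  - rewrite /y; under eq_bigr do rewrite mxE exprMn.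
    by rewrite -mulr_sumr (sqr_sqrtr (ltW s0)) -norm2_sqr x2 expr1n mulr1.
  by exists l; split => //; rewrite !bE.
have [l [l1 l2 l3]] := yr y.
(* The second rounding is adapted to the linear form defined by the first one; symmetry of [b] then
   lets it replace the remaining argument. *)
have [l' [l1' l2' l3']] := yr (signed_sum R l).
have bDl u v w : b (u + v) w = b u w + b v w.
  by rewrite /b raddfD/= !mulmxDl mxE.
have bNl u w : b (- u) w = - b u w by rewrite /b raddfN/= !mulNmx mxE.
have bZl a u w : b (a *: u) w = a * b u w.
  have -> : b (a *: u) w = (a *: (u^T *m M *m w)) ord0 ord0.
    by rewrite /b !scalemxAl; congr ((_ *m _ *m _) _ _); apply/matrixP => ? ?; rewrite !mxE.
  by rewrite mxE.
have yyE : b y y = s * b x x.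
  by rewrite /y bZl bC bZl mulrA -expr2 sqr_sqrtr ?ltW.
rewrite -/(b x x) -(ler_pM2l s0) -yyE (le_trans l3)// bC (le_trans l3')//.
pose z := signed_sum R l; pose z' := signed_sum R l'.
(* These lists encode [z + z'] and [z - z']; each has length at most [3 s + 3 s]. *)
have hP := hM (l ++ l').
have hN := hM (l ++ [seq (p.1, ~~ p.2) | p <- l']).
rewrite !size_cat size_map natrD !signed_sum_cat signed_sum_opp -/z -/z' in hP hN.
have {}hP : b (z + z') (z + z') <= delta * norm2 (z + z') ^+ 2.
  by apply: le_trans (ler_norm _) (hP _); lra.
have {}hN : - b (z - z') (z - z') <= delta * norm2 (z - z') ^+ 2.
  by rewrite -normrN in hN; apply: le_trans (ler_norm _) (hN _); lra.
have bD : b (z + z') (z + z') - b (z - z') (z - z') = 4 * b z z'.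
  rewrite !bDl !bNl ![b _ (z + z')]bC ![b _ (z - z')]bC !bDl !bNl (bC z' z); ring.
have nD : norm2 (z + z') ^+ 2 + norm2 (z - z') ^+ 2 =
    2 * (norm2 z ^+ 2 + norm2 z' ^+ 2).
  rewrite !norm2_sqr -!big_split mulr_sumr; apply: eq_bigr => i _ /=.
  by rewrite !mxE; ring.
rewrite -/z -/z' in l2 l2' *; nra.
Qed.

(** * Measurability of rho *)

Lemma norm2_ge0 (R : realType) n (x : 'cV[R]_n) : 0 <= norm2 x.
Proof. exact: sqrtr_ge0. Qed.

Lemma norm1_ge0 (R : realType) n (x : 'cV[R]_n) : 0 <= norm1 x.
Proof. exact: sumr_ge0. Qed.

Lemma norm2_gt0 (R : realType) n (x : 'cV[R]_n) : (0 < norm2 x) = (x != 0).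
Proof.
apply/idP/idP => [|x0].
  apply: contraTneq => ->; rewrite -leNgt /norm2 big1 ?sqrtr0// => i _.
  by rewrite mxE expr0n.
rewrite lt_neqAle norm2_ge0 andbT eq_sym; apply: contra x0 => /eqP x0.
have : \sum_i x i ord0 ^+ 2 == 0 by rewrite -norm2_sqr x0 expr0n.
rewrite psumr_eq0; last by move=> i _; rewrite sqr_ge0.
move=> /allP h; apply/eqP/colP => i; rewrite mxE; apply/eqP.
by rewrite -sqrf_eq0; apply: (implyP (h i _)) => //; exact: mem_index_enum.
Qed.

Lemma norm2Z (R : realType) n a (x : 'cV[R]_n) : norm2 (a *: x) = `|a| * norm2 x.
Proof.
rewrite /norm2 -sqrtr_sqr -sqrtrM ?sqr_ge0// mulr_sumr.
by congr Num.sqrt; apply: eq_bigr => i _; rewrite mxE exprMn.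
Qed.

Lemma norm1Z (R : realType) n a (x : 'cV[R]_n) : norm1 (a *: x) = `|a| * norm1 x.
Proof.
by rewrite /norm1 mulr_sumr; apply: eq_bigr => i _; rewrite mxE normrM.
Qed.

Lemma entry_le_norm2 (R : realType) n (x : 'cV[R]_n) i : `|x i ord0| <= norm2 x.
Proof.
rewrite -sqrtr_sqr ler_wsqrtr// (bigD1 i)//= lerDl sumr_ge0// => j _.
exact: sqr_ge0.
Qed.

(** After squaring, a coordinatewise comparison with [|x i| <= norm2 x] and [|e i| <= norm1 e]
    suffices, without Cauchy-Schwarz. *)
Lemma norm2_leD1 (R : realType) n (x e : 'cV[R]_n) :
  norm2 (x + e) <= norm2 x + norm1 e.
Proof.
have r0 : 0 <= norm2 x + norm1 e by rewrite addr_ge0 ?norm2_ge0 ?norm1_ge0.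
rewrite -(@ler_pXn2r _ 2) ?nnegrE ?norm2_ge0// norm2_sqr.
apply: (@le_trans _ _ (\sum_i (x i ord0 ^+ 2 + 2 * (norm2 x * `|e i ord0|) +
    norm1 e * `|e i ord0|))).
  apply: ler_sum => i _; rewrite mxE sqrrD lerD//.
    rewrite lerD2l -mulr_natl ler_wpM2l// (le_trans (ler_norm _))// normrM.
    by rewrite ler_wpM2r// entry_le_norm2.
  rewrite -real_normK ?num_real// expr2 ler_wpM2r// /norm1 (bigD1 i)//= lerDl.
  exact: sumr_ge0.
rewrite !big_split/= -!mulr_sumr -norm2_sqr -/(norm1 e); lra.
Qed.

Lemma norm1_mulmx_le (R : realType) m n (C : 'M[R]_(m, n)) (x : 'cV[R]_n) :
  norm1 (C *m x) <= (\sum_i \sum_j `|C i j|) * norm2 x.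
Proof.
rewrite mulr_suml; apply: ler_sum => i _; rewrite mxE mulr_suml.
rewrite (le_trans (ler_norm_sum _ _ _))//; apply: ler_sum => j _.
by rewrite normrM ler_wpM2l// entry_le_norm2.
Qed.

(** A minimizer for [B'] is a competitor for [B], and its quotient changes by at most the entrywise
    l1 norm of [B - B']. *)
Lemma rho_Lipschitz (R : realType) m n (s : R) (B B' : 'M[R]_(m, n)) :
  (1 <= n)%N -> 1 <= s ->
  rho s B <= rho s B' + \sum_i \sum_j `|B i j - B' i j|.
Proof.
move=> n1 s1; have [x [x0 xs -> _]] := rho_is_min B' n1 s1.
have [_ [_ _ _ /(_ x x0 xs)]] := rho_is_min B n1 s1; move=> /le_trans; apply.
have x20 : 0 < norm2 x by rewrite norm2_gt0.
rewrite ler_pdivrMr// mulrDl divfK ?gt_eqF//.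
have -> : B *m x = B' *m x + (B - B') *m x by rewrite -mulmxDl addrC subrK.
rewrite (le_trans (norm2_leD1 _ _))// lerD2l (le_trans (norm1_mulmx_le _ _))//.
rewrite le_eqVlt; apply/orP; left; apply/eqP; congr (_ * _).
by apply: eq_bigr => i _; apply: eq_bigr => j _; rewrite !mxE.
Qed.

(* A function that is 1-Lipschitz for the distance sum_ij |B i j - B' i j| is
   the infimum over rational B' of its upper cones at B'. *)
Lemma measurable_rho (R : realType) m n (s : R) d (T : measurableType d)
    (B : T -> 'M[R]_(m, n)) :
  (1 <= n)%N -> 1 <= s ->
  (forall i j, measurable_fun setT (fun w => B w i j)) ->
  measurable_fun setT (fun w => rho s (B w)).
Proof.
move=> n1 s1 mB.
apply: (measurability _ (RGenInftyO.measurableE R)) => _ [_ [a ->] <-].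
rewrite setTI.
pose cone (Q : 'M[rat]_(m, n)) w :=
  rho s (map_mx ratr Q) + \sum_i \sum_j `|B w i j - ratr (Q i j)|.
have mcone Q : measurable_fun setT (cone Q).
  apply: measurable_funD => //; apply: measurable_sum => i; apply: measurable_sum => j.
  by apply: measurableT_comp => //; apply: measurable_funB.
have -> : (fun w => rho s (B w)) @^-1` `]-oo, a[%classic =
    \bigcup_Q (cone Q @^-1` `]-oo, a[%classic).
  apply/seteqP; split=> [w|w [Q _]] /=; rewrite !in_itv/=; last first.
    apply: le_lt_trans; have := rho_Lipschitz (B w) (map_mx ratr Q) n1 s1.
    by rewrite /cone; under eq_bigr do under eq_bigr do rewrite mxE.
  (* The approximation error, at most [e m n], is paid twice: in the cone and in the Lipschitz
     bound. The successor keeps the total strictly below the gap [a - rho s (B w)]. *)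
  move=> wa; pose e := (a - rho s (B w)) / (2 * (m * n).+1%:R).
  have e0 : 0 < e by rewrite divr_gt0 ?subr_gt0// mulr_gt0.
  have /choice[Q BQ] (ij : 'I_m * 'I_n) : exists q : rat,
      `|B w ij.1 ij.2 - ratr q| < e.
    have [|q] := @rat_in_itvoo R (B w ij.1 ij.2 - e) (B w ij.1 ij.2 + e).
      by rewrite ltrD2l; lra.
    by rewrite in_itv/= => /andP[? ?]; exists q; rewrite ltr_norml; apply/andP; split; lra.
  exists (\matrix_(i, j) Q (i, j)) => //=; rewrite in_itv/= /cone.
  set Q' := \matrix_(i, j) _.
  have dle : \sum_i \sum_j `|B w i j - ratr (Q' i j)| <= e * (m * n)%:R.
    apply: (@le_trans _ _ (\sum_(i < m) \sum_(j < n) e)).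
      by apply: ler_sum => i _; apply: ler_sum => j _; rewrite mxE; exact/ltW/(BQ (i, j)).
    by rewrite !sumr_const !card_ord mulr_natr mulnC mulrnA.
  have := rho_Lipschitz (map_mx ratr Q') (B w) n1 s1.
  under eq_bigr do under eq_bigr do rewrite mxE distrC.
  have eE : 2 * (e * (m * n).+1%:R) = a - rho s (B w).
    have N0 : (m * n).+1%:R != 0 :> R by rewrite pnatr_eq0.
    by rewrite /e; move: (_.+1%:R) N0 => N N0; field.
  have : e * (m * n)%:R < e * (m * n).+1%:R by rewrite ltr_pM2l// ltr_nat.
  lra.
apply: countable_bigcupT_measurable => // Q.
by rewrite -[X in measurable X]setTI; exact: mcone.
Qed.

Lemma continuous_measurable_borel (R : realType) n (f : 'rV[R]_n -> R) :
  continuous f -> measurable_fun [set: borel_rV R n] (f : borel_rV R n -> R).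
Proof.
move=> cf; apply: (measurability _ (RGenInftyO.measurableE R)) => _ [_ [a ->] <-].
rewrite setTI; apply: sub_sigma_algebra.
by move/continuousP: cf; apply; exact: interval_open.
Qed.

(** * Products of independent variables *)

Section one_factor.
Local Open Scope ereal_scope.
Context (R : realType) d (T : measurableType d) (P : probability T R)
    d' (U : measurableType d') (Z : T -> U) (mZ : measurable_fun setT Z).
Import HBNNSimple.

(** The simple function [f] is split along its level sets, to each of which the hypothesis on
    indicators applies. *)
Lemma integral_factor_sfun (h : T -> R) (C : R) (f : {nnsfun U >-> R}) :
  measurable_fun setT h -> (forall x, 0 <= h x)%R ->
  (forall B, measurable B ->
    \int[P]_x (h x * \1_B (Z x))%:E = C%:E * P (Z @^-1` B)) ->
  (0 <= C)%R ->
  \int[P]_x (h x * f (Z x))%:E =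
    C%:E * \sum_(k \in range f) (k%:E * P (Z @^-1` (f @^-1` [set k]))).
Proof.
move=> mh h0 hB C0.
have m1 (B : set U) : measurable B -> measurable_fun setT (fun x => \1_B (Z x) : R).
  move=> mB; have mB1 : measurable_fun setT (\1_B : U -> R) by exact: measurable_indic.
  exact: (measurableT_comp mB1 mZ).
transitivity (\int[P]_x (\sum_(k \in range f)
    (k%:E * (h x * \1_(f @^-1` [set k]) (Z x))%:E))).
  apply: eq_integral => x _; rewrite {1}fimfunE mulr_fsumr -fsumEFin//.
  by apply: eq_fsbigr => k _; rewrite -EFinM mulrCA.
have k0 k x : 0 <= k%:E * (h x * \1_(f @^-1` [set k]) (Z x))%:E.
  rewrite -EFinM mulrCA EFinM; apply: mule_ge0; first by rewrite lee_fin.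
  by rewrite EFinM; exact: nnfun_muleindic_ge0.
rewrite ge0_integral_fsum//; last first.
  by move=> k; apply/measurable_EFinP; apply: measurable_funM => //;
    apply: measurable_funM => //; exact: m1.
rewrite ge0_mule_fsumr; last first.
  move=> k; have [k0'|k0'] := leP 0%R k; first by rewrite mule_ge0.
  by rewrite preimage_nnfun0// preimage_set0 measure0 mule0.
apply: eq_fsbigr => k /[!inE] -[y _ <-].
rewrite ge0_integralZl//; last 3 first.
- by apply/measurable_EFinP; apply: measurable_funM => //; exact: m1.
- by move=> x _; rewrite lee_fin mulr_ge0.
- by rewrite lee_fin.
by rewrite hB// muleCA.
Qed.

(** Monotone approximation extends the factorization from indicators to nonnegative functions of
    [Z]. Taking the full set for [B] shows that [C] is the expectation of [h]. *)
Lemma integral_factor (h : T -> R) (C : R) (f : U -> R) :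
  measurable_fun setT h -> (forall x, 0 <= h x)%R ->
  (forall B, measurable B ->
    \int[P]_x (h x * \1_B (Z x))%:E = C%:E * P (Z @^-1` B)) ->
  (0 <= C)%R ->
  measurable_fun setT f -> (forall y, 0 <= f y)%R ->
  \int[P]_x (h x * f (Z x))%:E = C%:E * \int[P]_x (f (Z x))%:E.
Proof.
move=> mh h0 hB C0 mf f0.
pose F := EFin \o f.
have mF : measurable_fun setT F by apply/measurable_EFinP.
pose f_ := nnsfun_approx measurableT mF.
have mfZ n : measurable_fun setT (fun x => f_ n (Z x)).
  exact: (measurableT_comp (f := f_ n)).
have F0 y : setT y -> 0 <= F y by rewrite lee_fin.
(* Applied to [h], and to the constant 1 in order to identify the limit of the sums; uniqueness of
   limits then concludes. *)
have key (g : T -> R) (D : R) : measurable_fun setT g -> (forall x, 0 <= g x)%R ->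
    (forall B, measurable B ->
      \int[P]_x (g x * \1_B (Z x))%:E = D%:E * P (Z @^-1` B)) -> (0 <= D)%R ->
    D%:E * \sum_(k \in range (f_ n)) (k%:E * P (Z @^-1` (f_ n @^-1` [set k])))
     @[n --> \oo] --> \int[P]_x (g x * f (Z x))%:E.
  move=> mg g0 gB D0.
  under eq_fun do rewrite -(integral_factor_sfun _ mg g0 gB D0).
  have -> : \int[P]_x (g x * f (Z x))%:E =
      \int[P]_x limn (fun n => (g x * f_ n (Z x))%:E).
    apply: eq_integral => x _; apply/esym/cvg_lim => //.
    under eq_fun do rewrite EFinM.
    rewrite EFinM; apply: cvgeZl => //.
    have := cvg_nnsfun_approx measurableT mF F0 (x := Z x) I.
    by rewrite /F /=; exact.
  apply: cvg_monotone_convergence => //.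
  - by move=> n; apply/measurable_EFinP; exact: measurable_funM.
  - by move=> n x _; rewrite lee_fin mulr_ge0.
  - move=> x _ m n mn; rewrite lee_fin ler_wpM2l//.
    exact/lefP/nd_nnsfun_approx.
have h1 := key _ _ mh h0 hB C0.
have h2 : \sum_(k \in range (f_ n)) (k%:E * P (Z @^-1` (f_ n @^-1` [set k])))
     @[n --> \oo] --> \int[P]_x (f (Z x))%:E.
  have := key (cst 1%R) 1%R (measurable_cst _) (fun=> ler01) _ ler01.
  under eq_fun do rewrite mul1e.
  under eq_integral do rewrite mul1r.
  apply => B mB; under eq_integral do rewrite mul1r.
  rewrite mul1e (eq_integral (fun x => (\1_(Z @^-1` B) x)%:E))// integral_indic ?setIT//.
  by rewrite -[X in measurable X]setTI; exact: mZ.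
have h3 : C%:E * \sum_(k \in range (f_ n)) (k%:E * P (Z @^-1` (f_ n @^-1` [set k])))
     @[n --> \oo] --> C%:E * \int[P]_x (f (Z x))%:E by exact: cvgeZl.
exact: (cvg_unique _ h1 h3).
Qed.

End one_factor.

Lemma integral_prod_independent (R : realType) d (T : measurableType d)
    (P : probability T R) d' (U : measurableType d') (I : finType)
    (Z : I -> T -> U) (f : I -> U -> R) :
  (forall i, measurable_fun setT (Z i)) ->
  (forall B : I -> set U, (forall i, measurable (B i)) ->
    P (\bigcap_i (Z i @^-1` B i)) = (\prod_i P (Z i @^-1` B i))%E) ->
  (forall i, measurable_fun setT (f i)) -> (forall i y, 0 <= f i y) ->
  (forall i, \int[P]_x (f i (Z i x))%:E < +oo)%E ->
  (\int[P]_x (\prod_i f i (Z i x))%:E = \prod_i \int[P]_x (f i (Z i x))%:E)%E.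
Proof.
move=> mZ ZP.
(* Induction on a list [r] of the indices whose factor may differ from an indicator: for the empty
   list this is independence, and each step frees one factor through [integral_factor]. *)
suff H (r : seq I) : forall f : I -> U -> R,
    (forall i, i \notin r -> exists2 B, measurable B & f i = \1_B) ->
    (forall i, measurable_fun setT (f i)) -> (forall i y, 0 <= f i y) ->
    (forall i, \int[P]_x (f i (Z i x))%:E < +oo)%E ->
    (\int[P]_x (\prod_i f i (Z i x))%:E = \prod_i \int[P]_x (f i (Z i x))%:E)%E.
  by apply: (H (index_enum I)) => i; rewrite mem_index_enum.
have PB i (B : set U) : measurable B -> (\int[P]_x (\1_B (Z i x))%:E = P (Z i @^-1` B))%E.
  move=> mB; rewrite (eq_integral (fun x => (\1_(Z i @^-1` B) x)%:E))//.
  by rewrite integral_indic ?setIT// -[X in measurable X]setTI; exact: mZ.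
elim: r => [{}f fB mf f0 foo|j r IH {}f fB mf f0 foo].
  have /choice[B /all_and2[mB fE]] : forall i, exists B, measurable B /\ f i = \1_B.
    by move=> i; have [//|B] := fB i; exists B.
  under [RHS]eq_bigr do rewrite fE PB//.
  rewrite -ZP// (eq_integral (fun x => (\1_(\bigcap_i (Z i @^-1` B i)) x)%:E)).
    rewrite integral_indic ?setIT//; apply: fin_bigcap_measurable => // i _.
    by rewrite -[X in measurable X]setTI; exact: mZ.
  move=> x _; congr (_%:E); rewrite indicE.
  have [xB|xB] := boolP (x \in \bigcap_i (Z i @^-1` B i)).
    rewrite big1// => i _; rewrite fE indicE mem_set//.
    by move: xB; rewrite inE; exact.
  apply/eqP; rewrite /= prodf_seq_eq0; apply/hasP.
  move/negP : xB; rewrite inE => /existsNP[i /not_implyP[_ xi]].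
  by exists i; rewrite ?mem_index_enum//= fE indicE memNset.
rewrite [RHS](bigD1 j)//=.
(* [integral_factor] takes a real constant, so the product of the other expectations has to be
   finite. *)
have fin i : (\int[P]_x (f i (Z i x))%:E \is a fin_num)%E.
  rewrite ge0_fin_numE// integral_ge0// => x _; by rewrite lee_fin.
have Cfin : (\prod_(i | i != j) \int[P]_x (f i (Z i x))%:E \is a fin_num)%E.
  by elim/big_ind : _ => // x y; exact: fin_numM.
have mfZ i : measurable_fun setT (fun x => f i (Z i x)).
  exact: (measurableT_comp (mf i)).
pose h x := \prod_(i | i != j) f i (Z i x).
transitivity (\int[P]_x (h x * f j (Z j x))%:E)%E.
  by apply: eq_integral => x _; rewrite (bigD1 j)//= mulrC.
rewrite muleC -(fineK Cfin).
apply: (integral_factor (mZ j)) => //.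
- rewrite /h; under eq_fun do rewrite big_mkcond/=.
  by apply: measurable_prod => i _; case: (i != j) => //; exact: mfZ.
- by move=> x; exact: prodr_ge0.
- move=> B mB; rewrite (fineK Cfin).
  (* With an indicator as factor [j], the induction hypothesis applies and yields the premise of
     [integral_factor]. *)
  pose f' i := if i == j then \1_B else f i.
  have f'j : f' j = \1_B by rewrite /f' eqxx.
  have f'i i : i != j -> f' i = f i by rewrite /f' => /negbTE ->.
  have := IH f'; rewrite (bigD1 j)//= f'j PB// muleC.
  rewrite [X in (_ = X * _)%E](_ : _ = \prod_(i | i != j) \int[P]_x (f i (Z i x))%:E)%E; last first.
    by apply: eq_bigr => i ij; rewrite f'i.
  rewrite (eq_integral (fun x => (h x * \1_B (Z j x))%:E)); last first.
    move=> x _; rewrite (bigD1 j)//= f'j mulrC; congr ((_ * _)%:E).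
    by apply: eq_bigr => i ij; rewrite f'i.
  apply.
  + move=> i ir; have [->|ij] := eqVneq i j; first by exists B.
    by rewrite f'i//; apply: fB; rewrite inE negb_or ij.
  + move=> i; have [->|ij] := eqVneq i j; last by rewrite f'i.
    by rewrite f'j; exact: measurable_indic.
  + move=> i y; have [->|ij] := eqVneq i j; last by rewrite f'i.
    by rewrite f'j.
  + move=> i; have [->|ij] := eqVneq i j; last by rewrite f'i.
    rewrite f'j PB// (le_lt_trans (probability_le1 _ _)) ?ltry//.
    by rewrite -[X in measurable X]setTI; exact: mZ.
- by rewrite fine_ge0// prode_ge0// => i _; apply: integral_ge0 => x _; rewrite lee_fin.
Qed.

(** * Bernstein inequality *)

(** By [e^x - 1 <= x e^x], the remainder [e^x - 1 - x] is at most [x (e^x - 1)], which is at most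
    [x^2 e^|x|] for either sign of [x]. *)
Lemma expR_le_quadratic (R : realType) (x : R) :
  expR x <= 1 + x + x ^+ 2 * expR `|x|.
Proof.
have e0 := expR_gt0 x.
have xex : expR x - 1 <= x * expR x.
  have := expR_ge1Dx (- x); rewrite expRN => /(ler_wpM2r (ltW e0)).
  rewrite mulVf ?gt_eqF//; lra.
have exx := expR_ge1Dx x.
have [x0|x0] := leP 0 x; first by rewrite ger0_norm//; nra.
have : 1 <= expR `|x| by rewrite -expR0 ler_expR.
nra.
Qed.

Definition mgf_const (R : realType) (K : R) : R :=
  Num.max 1 (4 * K) ^+ 2 * expR (2 * K)^-1.

Lemma mgf_const_gt0 (R : realType) (K : R) : 0 < mgf_const K.
Proof.
rewrite /mgf_const mulr_gt0 ?expR_gt0// exprn_gt0//.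
by rewrite lt_max ltr01.
Qed.

(** Twice this rate bounds the exponential parameter: the first term of the minimum keeps it in the
    range of the moment bound, the second makes the quadratic term at most half of the linear
    one. *)
Definition bernstein_rate (R : realType) (K : R) : R :=
  Num.min (2 * K)^-1 (4 * mgf_const K)^-1 / 2.

Lemma bernstein_rate_gt0 (R : realType) (K : R) : 0 < K -> 0 < bernstein_rate K.
Proof.
move=> K0; rewrite divr_gt0// lt_min !invr_gt0.
by apply/andP; split; apply: mulr_gt0 => //; exact: mgf_const_gt0.
Qed.

(** Half of the exponent [y / K] absorbs [(y - 1)^2], the other half absorbs [exp |theta (y - 1)|];
    the two estimates give the two factors of [mgf_const]. *)
Lemma expR_centered_le (R : realType) (K theta y : R) :
  0 < K -> `|theta| <= (2 * K)^-1 -> 0 <= y ->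
  expR (theta * (y - 1)) <=
    1 + theta * (y - 1) + theta ^+ 2 * (mgf_const K * expR (y / K)).
Proof.
move=> K0 tK y0.
apply: (le_trans (expR_le_quadratic _)); rewrite lerD2l exprMn -mulrA.
rewrite ler_wpM2l ?sqr_ge0// /mgf_const.
set a := Num.max 1 (4 * K).
have a1 : 1 <= a by rewrite le_max lexx.
have aK : 4 * K <= a by rewrite le_max lexx orbT.
have eE : expR (y / K) = expR (y / (4 * K)) ^+ 2 * expR (y / (2 * K)).
  rewrite -expRM_natl -expRD; congr expR; field; lra.
have sq : (y - 1) ^+ 2 <= a ^+ 2 * expR (y / (4 * K)) ^+ 2.
  rewrite -exprMn.
  have : 1 + y <= a * (1 + y / (4 * K)).
    rewrite mulrDr mulr1 lerD// mulrCA ler_peMr// ler_pdivlMr ?mul1r//.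
    by rewrite mulr_gt0.
  have := ler_wpM2l (le_trans ler01 a1) (expR_ge1Dx (y / (4 * K))).
  move: (a * expR _) => b; nra.
have ab : expR `|theta * (y - 1)| <= expR (2 * K)^-1 * expR (y / (2 * K)).
  rewrite -expRD ler_expR normrM.
  have -> : (2 * K)^-1 + y / (2 * K) = (2 * K)^-1 * (y + 1) by field; lra.
  apply: ler_pM => //; rewrite ler_norml; apply/andP; split; lra.
rewrite eE (le_trans (ler_pM _ _ sq ab)) ?sqr_ge0 ?expR_ge0//.
by rewrite le_eqVlt; apply/orP; left; apply/eqP; ring.
Qed.

(** The linear term has mean zero, and [1 + x <= exp x] turns the remaining second-order bound into
    an exponential. *)
Lemma mgf_centered_le (R : realType) d (T : measurableType d)
    (P : probability T R) (K theta : R) (Y : T -> R) :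
  0 < K -> `|theta| <= (2 * K)^-1 ->
  measurable_fun setT Y -> (forall x, 0 <= Y x) ->
  (\int[P]_x (Y x)%:E = 1)%E ->
  (\int[P]_x (expR (Y x / K))%:E <= 2%:E)%E ->
  (\int[P]_x (expR (theta * (Y x - 1)))%:E <=
     (expR (2 * mgf_const K * theta ^+ 2))%:E)%E.
Proof.
move=> K0 tK mY Y0 EY EK.
have c0 : 0 <= theta ^+ 2 * mgf_const K.
  by rewrite mulr_ge0 ?sqr_ge0// ltW// mgf_const_gt0.
have mexp a b : measurable_fun setT (fun x => expR (a * (Y x - b))).
  by apply: measurableT_comp => //; apply: measurable_funM => //; exact: measurable_funB.
have mexpK : measurable_fun setT (fun x => expR (Y x / K)).
  by apply: measurableT_comp => //; exact: measurable_funM.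
have cst1 (c : R) : (\int[P]_x c%:E = c%:E)%E.
  by rewrite integral_cst// [X in (_ * X)%E]probability_setT mule1.
have mlin a b : measurable_fun setT (fun x => a * Y x + b).
  by apply: measurable_funD => //; exact: measurable_funM.
have intL (a b : R) : 0 <= a -> 0 <= b -> (\int[P]_x (a * Y x + b)%:E = (a + b)%:E)%E.
  move=> a0 b0; under eq_integral do rewrite EFinD EFinM.
  rewrite ge0_integralD//; last 2 first.
  - by move=> x _; rewrite -EFinM lee_fin mulr_ge0.
  - by apply/measurable_EFinP; exact: measurable_funM.
  rewrite cst1 ge0_integralZl// ?EY ?mule1//; first exact/measurable_EFinP.
  by move=> x _; rewrite lee_fin.
have intK : (\int[P]_x (theta ^+ 2 * mgf_const K * expR (Y x / K))%:E <=
    (2 * mgf_const K * theta ^+ 2)%:E)%E.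
  under eq_integral do rewrite EFinM.
  rewrite ge0_integralZl//; last exact/measurable_EFinP.
  apply: (le_trans (lee_wpmul2l _ EK)) => //.
  by rewrite -EFinM lee_fin le_eqVlt; apply/orP; left; apply/eqP; ring.
have pt x := expR_centered_le K0 tK (Y0 x).
suff : (\int[P]_x (expR (theta * (Y x - 1)))%:E <=
    (1 + 2 * mgf_const K * theta ^+ 2)%:E)%E.
  by move=> /le_trans; apply; rewrite lee_fin expR_ge1Dx.
(* Positive and negative parts of theta keep every integrand nonnegative. *)
pose p := (`|theta| + theta) / 2; pose q := (`|theta| - theta) / 2.
have p0 : 0 <= p.
  by have := ler_norm (- theta); rewrite normrN /p => ?; lra.
have q0 : 0 <= q by have := ler_norm theta; rewrite /q => ?; lra.
have mE (f : T -> R) : measurable_fun setT f -> measurable_fun setT (fun x => (f x)%:E).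
  by move=> ?; exact/measurable_EFinP.
have intLD (a b : R) (f : T -> R) : 0 <= a -> 0 <= b ->
    measurable_fun setT f -> (forall x, 0 <= f x) ->
    (\int[P]_x (f x + (a * Y x + b))%:E = \int[P]_x (f x)%:E + (a + b)%:E)%E.
  move=> a0 b0 mf f0; under eq_integral do rewrite EFinD.
  rewrite ge0_integralD ?intL//; do ?[exact: mE] => x _; rewrite lee_fin//.
  by rewrite addr_ge0// mulr_ge0.
have mQ : measurable_fun setT (fun x => theta ^+ 2 * mgf_const K * expR (Y x / K)).
  exact: measurable_funM.
(* As [theta = p - q], adding [q Y + p] to both sides of the pointwise bound removes all negative
   terms; since [Y] has mean 1, the additions cancel after integration. *)
rewrite -(@leeD2rE _ (q + p)%:E)// -intLD//.
apply: (@le_trans _ _ (\int[P]_x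
    (theta ^+ 2 * mgf_const K * expR (Y x / K) + (p * Y x + (1 + q)))%:E)%E).
  apply: ge0_le_integral => //.
  - by move=> x _; rewrite lee_fin addr_ge0 ?expR_ge0// addr_ge0// mulr_ge0.
  - by apply: mE; exact: measurable_funD.
  - by apply: mE; exact: measurable_funD.
  - move=> x _; rewrite lee_fin; have := pt x.
    have tE : theta = p - q by rewrite /p /q; lra.
    rewrite mulrA; move: (expR _) (_ * expR _) => e1 e2.
    by rewrite [in X in X -> _]tE; lra.
rewrite intLD ?addr_ge0//; last by move=> x; rewrite mulr_ge0 ?expR_ge0.
apply: (le_trans (leeD2r _ intK)).
by rewrite -!EFinD lee_fin; lra.
Qed.

(** * Exponential tail bounds for sums of independent variables *)

Section chernoff.
Context (R : realType) d (T : measurableType d) (P : probability T R)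
  d' (U : measurableType d') (I : finType) (X : I -> T -> U) (g : U -> R) (K : R).
Hypothesis mX : forall i, measurable_fun setT (X i).
Hypothesis indX : forall B : I -> set U, (forall i, measurable (B i)) ->
  P (\bigcap_i (X i @^-1` B i)) = (\prod_i P (X i @^-1` B i))%E.
Hypothesis mg : measurable_fun setT g.
Hypothesis g0 : forall y, 0 <= g y.
Hypothesis Eg : forall i, (\int[P]_x (g (X i x))%:E = 1)%E.
Hypothesis K0 : 0 < K.
Hypothesis EgK : forall i, (\int[P]_x (expR (g (X i x) / K))%:E <= 2%:E)%E.

Let mgX i : measurable_fun setT (fun x => g (X i x)).
Proof. exact: (measurableT_comp mg (mX i)). Qed.

Lemma measurable_centered_sum (theta : R) :
  measurable_fun setT (fun x => theta * \sum_i (g (X i x) - 1)).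
Proof.
apply: measurable_funM => //; apply: measurable_sum => i.
exact: measurable_funB.
Qed.

(** Markov's inequality for the exponential, whose expectation factors by independence. Both signs
    of [theta] are allowed, one for each tail. *)
Lemma chernoff_centered_sum (theta c : R) : `|theta| <= (2 * K)^-1 ->
  (P [set x | c <= theta * \sum_i (g (X i x) - 1)]%R <=
    (expR (2 * mgf_const K * theta ^+ 2 * #|I|%:R - c))%:E)%E.
Proof.
move=> tK; set A := [set x | _].
have mA : measurable A.
  rewrite [A](_ : _ = (fun x => theta * \sum_i (g (X i x) - 1)) @^-1` `[c, +oo[); last first.
    by apply/seteqP; split=> x /=; rewrite in_itv/= andbT.
  by rewrite -[X in measurable X]setTI; exact: measurable_centered_sum.
pose f (i : I) y := expR (theta * (g y - 1)).
have mf i : measurable_fun setT (f i).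
  by apply: measurableT_comp => //; apply: measurable_funM => //; exact: measurable_funB.
have fb i : (\int[P]_x (f i (X i x))%:E <= (expR (2 * mgf_const K * theta ^+ 2))%:E)%E.
  exact: mgf_centered_le.
have fprod := integral_prod_independent mX indX mf (fun i y => expR_ge0 _)
  (fun i => le_lt_trans (fb i) (ltry _)).
have fE x : \prod_i f i (X i x) = expR (theta * \sum_i (g (X i x) - 1)).
  by rewrite mulr_sumr expR_sum.
have mprod : measurable_fun setT (fun x => \prod_i f i (X i x)).
  by apply: measurable_prod => i _; exact: (measurableT_comp (mf i) (mX i)).
apply: (@le_trans _ _ (\int[P]_x ((expR (- c))%:E * (\prod_i f i (X i x))%:E))%E).
  have -> : P A = (\int[P]_x (\1_A x)%:E)%E by rewrite integral_indic ?setIT.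
  apply: ge0_le_integral => //.
  - by apply/measurable_EFinP; exact: measurable_indic.
  - by apply/measurable_EFinP; exact: measurable_funM.
  - move=> x _; rewrite -EFinM lee_fin fE -expRD indicE.
    have [/[!inE] xA|_] := boolP (x \in A); last exact: expR_ge0.
    by rewrite -[leLHS]expR0 ler_expR addrC subr_ge0; exact: xA.
rewrite ge0_integralZl//; do ?[exact/measurable_EFinP | by rewrite lee_fin expR_ge0 |
  by move=> x _; rewrite lee_fin fE expR_ge0].
rewrite fprod addrC expRD EFinM lee_wpmul2l ?lee_fin ?expR_ge0//.
apply: (@le_trans _ _ (\prod_(i in I) (expR (2 * mgf_const K * theta ^+ 2))%:E)%E).
  suff [] : (0 <= \prod_i \int[P]_x (f i (X i x))%:E /\ \prod_i \int[P]_x (f i (X i x))%:E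
      <= \prod_(i in I) (expR (2 * mgf_const K * theta ^+ 2))%:E)%E by [].
  apply: (big_ind2 (fun x y => 0 <= x /\ x <= y)%E) => //.
    move=> x1 x2 y1 y2 [x0 xy] [y0 yy]; split; first exact: mule_ge0.
    exact: lee_pmul.
  move=> i _; split; last exact: fb.
  by apply: integral_ge0 => x _; rewrite lee_fin expR_ge0.
by rewrite prodEFin prodr_const -expRM_natr lee_fin.
Qed.

(** The parameter [v], below both [t] and [t^2], treats the subgaussian and the subexponential
    regimes at once. *)
Lemma bernstein_centered_sum (v t : R) : (0 < #|I|)%N ->
  0 < v -> 0 < t -> v <= t -> v <= t ^+ 2 ->
  (P [set x | t <= `|(\sum_i g (X i x)) / #|I|%:R - 1|]%R <=
    (2 * expR (- (bernstein_rate K * v * #|I|%:R)))%:E)%E.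
Proof.
move=> I0 v0 t0 vt vt2; set kappa := bernstein_rate K.
have k1 : 2 * kappa <= (2 * K)^-1.
  have -> : 2 * kappa = Num.min (2 * K)^-1 (4 * mgf_const K)^-1 by rewrite /kappa /bernstein_rate; lra.
  by rewrite ge_min lexx.
have D0 := mgf_const_gt0 K.
have k2 : 2 * mgf_const K * (2 * kappa) <= 2^-1.
  have : 2 * kappa <= (4 * mgf_const K)^-1.
    have -> : 2 * kappa = Num.min (2 * K)^-1 (4 * mgf_const K)^-1 by rewrite /kappa /bernstein_rate; lra.
    by rewrite ge_min lexx orbT.
  move=> /(ler_wpM2l (_ : 0 <= 2 * mgf_const K)) /le_trans; apply; first by lra.
  by rewrite le_eqVlt; apply/orP; left; apply/eqP; field; lra.
have k0 : 0 < kappa by exact: bernstein_rate_gt0.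
have N0 : 0 < #|I|%:R :> R by rewrite ltr0n.
(* The linear gain is then [theta t = 2 kappa v] and the quadratic loss at most [kappa v], which
   leaves [- kappa v] per variable. *)
pose theta := 2 * kappa * (v / t).
have vt1 : 0 < v / t <= 1.
  by rewrite divr_gt0//= ler_pdivrMr// mul1r.
have [vt0 vt1'] := andP vt1.
have th0 : 0 < theta by apply: mulr_gt0 => //; exact: mulr_gt0.
have thK : theta <= (2 * K)^-1.
  by apply: le_trans k1; rewrite /theta ler_piMr// mulr_ge0// ltW.
have tht : theta * t = 2 * kappa * v by rewrite /theta; field; lra.
have thv : 2 * mgf_const K * theta ^+ 2 <= kappa * v.
  have h : 2 * mgf_const K * theta <= t / 2.
    rewrite /theta mulrA (le_trans (ler_wpM2r _ k2)) ?(ltW (divr_gt0 v0 t0))//.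
    have : v / t <= t by rewrite ler_pdivrMr.
    by rewrite mulrC; lra.
  have -> : kappa * v = t / 2 * theta by lra.
  by rewrite expr2 mulrA ler_pM2r.
pose S x := \sum_i (g (X i x) - 1).
have SE x : (\sum_i g (X i x)) / #|I|%:R - 1 = S x / #|I|%:R.
  by rewrite /S sumrB sumr_const mulrBl -(mulr_natl 1) mulr1 divff ?gt_eqF.
pose c := theta * t * #|I|%:R.
have side (e : R) : `|e| = theta ->
    (P [set x | c <= e * S x]%R <= (expR (- (kappa * v * #|I|%:R)))%:E)%E.
  move=> eE; apply: (le_trans (@chernoff_centered_sum e c _)); first by rewrite eE.
  rewrite lee_fin ler_expR -(real_normK (num_real e)) eE /c tht.
  have := ler_wpM2r (ltW N0) thv; lra.
have mside (e : R) : measurable [set x | c <= e * S x]%R.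
  rewrite [X in measurable X](_ : _ = (fun x => e * S x) @^-1` `[c, +oo[); last first.
    by apply/seteqP; split=> x /=; rewrite in_itv/= andbT.
  by rewrite -[X in measurable X]setTI; exact: measurable_centered_sum.
apply: (@le_trans _ _ (P ([set x | c <= theta * S x]%R `|` [set x | c <= - theta * S x]%R))).
  apply: le_measure; rewrite ?inE.
  - rewrite [X in measurable X](_ : _ = (fun x => 1 * S x) @^-1`
        ((fun y => `|y / #|I|%:R|) @^-1` `[t, +oo[)); last first.
      by apply/seteqP; split=> x /=; rewrite in_itv/= andbT mul1r SE.
    rewrite -[X in measurable X]setTI; apply: measurable_centered_sum => //.
    have mn : measurable_fun setT (fun y : R => `|y / #|I|%:R|).
      by apply: measurableT_comp => //; exact: measurable_funM.
    by rewrite -[X in measurable X]setTI; exact: mn.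
  - exact: measurableU.
  - move=> x /=; rewrite SE normrM normfV (gtr0_norm N0) ler_pdivlMr//.
    rewrite ler_normr /c => /orP[h|h]; [left|right].
      by rewrite -mulrA ler_pM2l.
    by rewrite -mulrA mulNr -mulrN ler_pM2l.
rewrite (le_trans (measureU2 _ _ _))//.
rewrite mulr_natl mulr2n EFinD leeD// side// ?normrN ger0_norm//; exact: ltW.
Qed.

End chernoff.

(** * Deviation of rho from 1 *)

Lemma gram_entry (R : realType) m n (B : 'M[R]_(m, n)) (z : 'cV[R]_n) :
  (z^T *m (1%:M - B^T *m B) *m z) ord0 ord0 = norm2 z ^+ 2 - norm2 (B *m z) ^+ 2.
Proof.
have sq k (x : 'cV[R]_k) : norm2 x ^+ 2 = (x^T *m x) ord0 ord0.
  by rewrite norm2_sqr mxE; apply: eq_bigr => i _; rewrite !mxE expr2.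
rewrite !sq trmx_mul mulmxBr mulmx1 mulmxBl !mulmxA.
have entryB (C D : 'M[R]_1) : (C - D) ord0 ord0 = C ord0 ord0 - D ord0 ord0.
  by rewrite !mxE.
by rewrite entryB.
Qed.

(* For eps > 1 only the upper bound has content, and the larger threshold
   eps ^+ 2 is what makes the tail bound decay like exp (- eps ^+ 2 m). *)
Definition dev_threshold (R : realType) (eps : R) : R :=
  if eps <= 1 then eps / 6 else eps ^+ 2.

(** For [eps <= 1], [quadratic_sparse_bound] with [delta = eps / 6] at the normalized minimizer
    gives [rho^2 >= 1 - eps >= (1 - eps)^2]; for [eps > 1] the lower bound is trivial. A basis
    vector gives the upper bound. *)
Lemma rho_near1 (R : realType) m n (s eps : R) (B : 'M[R]_(m, n)) :
  (1 <= n)%N -> 1 <= s -> 0 < eps ->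
  (forall l : seq ('I_n * bool), (size l)%:R <= 6 * s ->
    signed_sum R l != 0 ->
    `|norm2 (B *m signed_sum R l) ^+ 2 / norm2 (signed_sum R l) ^+ 2 - 1|
       < dev_threshold eps) ->
  1 - eps <= rho s B <= 1 + eps.
Proof.
case: n B => // n B n1 s1 e0 hB.
have [x [x0 xs rE rmin]] := rho_is_min B n1 s1.
have x20 : 0 < norm2 x by rewrite norm2_gt0.
apply/andP; split.
  have [e1|e1] := leP eps 1; last first.
    by rewrite rE; apply: (@le_trans _ _ 0); [lra|rewrite divr_ge0 ?norm2_ge0].
  pose y := (norm2 x)^-1 *: x.
  have y2 : norm2 y = 1.
    by rewrite /y norm2Z ger0_norm ?invr_ge0 ?norm2_ge0// mulVf ?gt_eqF.
  have y1 : norm1 y <= Num.sqrt s.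
    rewrite /y norm1Z -[leLHS]ger0_norm ?mulr_ge0 ?norm1_ge0//.
    rewrite -sqrtr_sqr ler_wsqrtr// exprMn real_normK ?num_real// exprVn mulrC.
    exact: xs.
  have rEy : rho s B = norm2 (B *m y).
    by rewrite rE /y -scalemxAr norm2Z ger0_norm ?invr_ge0 ?norm2_ge0// mulrC.
  have MT : (1%:M - B^T *m B)^T = 1%:M - B^T *m B.
    by rewrite raddfB/= trmx1 trmx_mul trmxK.
  have := @quadratic_sparse_bound R n.+1 s (eps / 6) _ y MT s1 _ _ y2 y1.
  have d0 : 0 <= eps / 6 by lra.
  move=> /(_ d0); rewrite gram_entry y2 expr1n => h.
  have {}h : 1 - norm2 (B *m y) ^+ 2 <= 6 * (eps / 6).
    apply: h => l ls; rewrite gram_entry.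
    (* A list may cancel to the zero vector, which the hypothesis on quotients excludes; both sides
       then vanish. *)
    have [->|z0] := eqVneq (signed_sum R l) 0.
      have norm20 k : norm2 (0 : 'cV[R]_k) = 0.
        by rewrite -(scale0r 0) norm2Z normr0 mul0r.
      by rewrite mulmx0 !norm20 expr0n/= mulr0 subrr normr0.
    have := ltW (hB l ls z0); rewrite /dev_threshold e1.
    set z := signed_sum R l in z0 *.
    have z20 : 0 < norm2 z ^+ 2 by rewrite exprn_gt0// norm2_gt0.
    rewrite -(ler_pM2r z20) -[X in _ * X <= _](gtr0_norm z20) -normrM mulrBl mul1r.
    by rewrite divfK ?gt_eqF// distrC.
  rewrite rEy -(@ler_pXn2r _ 2) ?nnegrE ?norm2_ge0//; last by lra.
  by move: h; move: (norm2 _ ^+ 2) => b; nra.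
pose e1 : 'cV[R]_n.+1 := signed_sum R [:: (ord0, false)].
have e1E : e1 = delta_mx ord0 ord0 by rewrite /e1 /signed_sum big_seq1 expr0 scale1r.
have e12 : norm2 e1 = 1.
  rewrite e1E /norm2 (bigD1 ord0)//= big1 ?addr0; last first.
    by move=> i i0; rewrite !mxE/= (negbTE i0) expr0n.
  by rewrite !mxE/= expr1n sqrtr1.
have e11 : norm1 e1 = 1.
  rewrite e1E /norm1 (bigD1 ord0)//= big1 ?addr0; last first.
    by move=> i i0; rewrite !mxE/= (negbTE i0) normr0.
  by rewrite !mxE/= normr1.
have e10 : e1 != 0 by rewrite -norm2_gt0 e12.
apply: (le_trans (rmin e1 e10 _)); first by rewrite /l1_sparsity e11 e12 expr1n divr1.
have := hB [:: (ord0, false)]; rewrite -/e1 e12 expr1n !divr1 => /(_ _ e10) h.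
rewrite -(@ler_pXn2r _ 2) ?nnegrE ?norm2_ge0//; last by lra.
have {}h : `|norm2 (B *m e1) ^+ 2 - 1| < dev_threshold eps by apply: h; rewrite /=; lra.
have := le_lt_trans (ler_norm _) h; rewrite /dev_threshold.
move: (norm2 _ ^+ 2) => b; case: ifPn => [?|_]; nra.
Qed.

Lemma measurable_inner (R : realType) n (u : 'cV[R]_n) :
  measurable_fun [set: borel_rV R n] (fun x : borel_rV R n => inner x u).
Proof.
apply: (@continuous_measurable_borel R n (fun x => inner x u)).
rewrite /inner; under eq_fun do rewrite mxE.
apply: continuous_big => // [|j _]; first exact: add_continuous.
have cj : continuous (fun v : 'rV[R]_n => v ord0 j) by exact: coord_continuous.
by move=> v; exact: (cvgMr_tmp (cj v)).
Qed.

(** A psi2 norm at most [L] guarantees an admissible [t < 2 L] without attainment of the infimum,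
    hence the scale [4 L^2]. *)
Lemma subgaussian_psi2 (R : realType) d (T : measurableType d)
    (P : probability T R) n (L : R) (X : T -> 'rV[R]_n) (u : 'cV[R]_n) :
  0 < L -> random_vector X -> subgaussian P L X -> norm2 u = 1 ->
  (\int[P]_w (expR (inner (X w) u ^+ 2 / (4 * L ^+ 2)))%:E <= 2%:E)%E.
Proof.
move=> L0 mX /(_ u) + u1; rewrite u1 mulr1 => psiL.
have /ereal_inf_lt[_ [t [t0 tE] <-] tL] : (psi2_norm P (fun w => inner (X w) u) < (2 * L)%:E)%E.
  by apply: (le_lt_trans psiL); rewrite lte_fin; lra.
rewrite lte_fin in tL.
apply: le_trans tE; rewrite unlock.
have mi : measurable_fun setT (fun w => inner (X w) u).
  exact: (measurableT_comp (measurable_inner u) mX).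
apply: ge0_le_integral => //.
- apply/measurable_EFinP; apply: measurableT_comp => //.
  by apply: measurable_funM => //; exact: measurable_funX.
- apply/measurable_EFinP; apply: measurableT_comp => //.
  by apply: measurable_funM => //; apply: measurable_funX; exact: measurableT_comp.
- move=> w _; rewrite lee_fin ler_expR real_normK ?num_real// ler_wpM2l ?sqr_ge0//.
  rewrite lef_pV2 ?posrE ?exprn_gt0//; last by rewrite mulr_gt0 ?exprn_gt0.
  have -> : 4 * L ^+ 2 = (2 * L) ^+ 2 by ring.
  by rewrite ler_sqr ?nnegrE; lra.
Qed.

(** The base [2 n + 1] counts the signed indices and a blank. It is at most [n^3], and the factor 2
    of the two-sided tail is at most [n], so the power of [n] is at most [1 + 18 s <= 19 s]. *)
Lemma net_card_le (R : realType) (n : nat) (s : R) : (2 <= n)%N -> 1 <= s ->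
  2 * ((2 * n).+1 ^ Num.truncn (6 * s))%N%:R <= expR (19 * (s * ln n%:R)) :> R.
Proof.
move=> n2 s1; set N := Num.truncn _.
have n0 : 0 < n%:R :> R by rewrite ltr0n (leq_trans _ n2).
have NS : N%:R <= 6 * s.
  have s0 : 0 <= 6 * s by lra.
  by have /andP[] := truncn_itv s0.
have ln0 : 0 <= ln n%:R :> R by rewrite ln_ge0// ler1n (leq_trans _ n2).
apply: (@le_trans _ _ (n ^ (1 + 3 * N))%N%:R).
  rewrite -natrM ler_nat expnD expn1 expnM leq_mul//.
  have n3 : ((2 * n).+1 <= n ^ 3)%N.
    rewrite !expnS expn0 muln1.
    have : (2 * (2 * n) <= n * (n * n))%N by rewrite leq_mul ?leq_mul.
    apply: leq_trans; rewrite [leqRHS]mul2n -addnn -[leqLHS]addn1 leq_add2l.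
    by rewrite muln_gt0 (leq_trans _ n2).
  by case: N {NS} => // N; rewrite leq_exp2r.
rewrite natrX -[n%:R in leLHS]lnK ?posrE// -expRM_natl ler_expR mulrA.
rewrite ler_wpM2r// natrD natrM; lra.
Qed.

(** * Union bound over the net, and expectation of the deviation *)

Section tail.
Context (R : realType) (L : R) (n m : nat) (s : R) d (T : measurableType d)
  (P : probability T R) (A : T -> 'M[R]_(m, n)).
Hypotheses (L_gt0 : 0 < L) (n2 : (2 <= n)%N) (m1 : (1 <= m)%N) (s1 : 1 <= s).
Hypothesis mA : forall i : 'I_m, random_vector (fun w => row i (A w)).
Hypothesis indA : mutually_independent P (fun (i : 'I_m) w => row i (A w)).
Hypothesis isoA : forall i : 'I_m, isotropic P (fun w => row i (A w)).
Hypothesis subA : forall i : 'I_m, subgaussian P L (fun w => row i (A w)).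

Let K := 4 * L ^+ 2.
Let kappa := bernstein_rate K.
Let B w := (Num.sqrt m%:R)^-1 *: A w.

Let K_gt0 : 0 < K. Proof. by rewrite mulr_gt0// exprn_gt0. Qed.

Let kappa_gt0 : 0 < kappa. Proof. exact: bernstein_rate_gt0. Qed.

Let deviation (z : 'cV[R]_n) w := `|norm2 (B w *m z) ^+ 2 / norm2 z ^+ 2 - 1|.

(** Normalizing [z] exhibits the empirical mean of one fixed function of the rows, the form that the
    Bernstein bound requires. *)
Let deviationE z w : z != 0 -> deviation z w =
  `|(\sum_i inner (row i (A w)) ((norm2 z)^-1 *: z) ^+ 2) / #|'I_m|%:R - 1|.
Proof.
rewrite -norm2_gt0 => z0; congr (`|_ - 1|).
rewrite norm2_sqr card_ord mulr_suml [RHS]mulr_suml; apply: eq_bigr => i _.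
have -> : inner (row i (A w)) ((norm2 z)^-1 *: z) = (norm2 z)^-1 * (A w *m z) i ord0.
  by rewrite /inner -row_mul -scalemxAr [LHS]mxE [LHS]mxE.
have -> : (B w *m z) i ord0 = (Num.sqrt m%:R)^-1 * (A w *m z) i ord0.
  by rewrite /B -scalemxAl mxE.
by rewrite !exprMn !exprVn sqr_sqrtr//; ring.
Qed.

Lemma deviation_tail (z : 'cV[R]_n) (v t : R) : z != 0 ->
  0 < v -> 0 < t -> v <= t -> v <= t ^+ 2 ->
  (P [set w | t <= deviation z w]%R <= (2 * expR (- (kappa * v * m%:R)))%:E)%E.
Proof.
move=> z0 v0 t0 vt vt2.
pose u := (norm2 z)^-1 *: z.
have u1 : norm2 u = 1.
  by rewrite norm2Z ger0_norm ?invr_ge0 ?norm2_ge0// mulVf ?gt_eqF// norm2_gt0.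
pose g (x : borel_rV R n) := inner x u ^+ 2.
have -> : [set w | t <= deviation z w] =
    [set w | t <= `|(\sum_i g (row i (A w))) / #|'I_m|%:R - 1|].
  by apply/seteqP; split=> w /=; rewrite deviationE.
have indX (C : 'I_m -> set (borel_rV R n)) : (forall i, measurable (C i)) ->
    P (\bigcap_i ((fun w => row i (A w)) @^-1` C i)) =
    (\prod_i P ((fun w => row i (A w)) @^-1` C i))%E.
  move=> mC; have := indA (J := finset.setT) (fun i _ => mC i).
  have -> : [set` finset.setT] = [set: 'I_m].
    by apply/seteqP; split=> i //= _; rewrite inE.
  by move=> ->; apply: eq_bigl => i; rewrite inE.
have mg : measurable_fun setT g by apply: measurable_funX; exact: measurable_inner.
have g0 y : 0 <= g y by rewrite sqr_ge0.
have Eg i : (\int[P]_w (g (row i (A w)))%:E = 1)%E.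
  have := isoA i u; rewrite u1 expr1n unlock => <-.
  by apply: eq_integral => w _; rewrite /g real_normK ?num_real.
have EgK i : (\int[P]_w (expR (g (row i (A w)) / K))%:E <= 2%:E)%E.
  exact: subgaussian_psi2.
have I0 : (0 < #|'I_m|)%N by rewrite card_ord.
have := @bernstein_centered_sum R d T P _ (borel_rV R n) 'I_m
  (fun i w => row i (A w)) g K mA indX mg g0 Eg K_gt0 EgK v t I0 v0 t0 vt vt2.
by rewrite [in X in expR X]card_ord.
Qed.

Let measurable_entry i j : measurable_fun setT (fun w => A w i j).
Proof.
have mc : measurable_fun setT (fun x : borel_rV R n => x ord0 j).
  by apply: (@continuous_measurable_borel R n (fun x => x ord0 j)); exact: coord_continuous.
have := measurableT_comp mc (mA i).
by apply: eq_measurable_fun => w _ /=; rewrite mxE.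
Qed.

Lemma measurable_rho_scaled : measurable_fun setT (fun w => rho s (B w)).
Proof.
apply: measurable_rho => //; first exact: leq_trans n2.
move=> i j; under eq_fun do rewrite mxE; exact: measurable_funM.
Qed.

Lemma measurable_deviation z : measurable_fun setT (deviation z).
Proof.
rewrite /deviation; apply: measurableT_comp => //; apply: measurable_funB => //.
apply: measurable_funM => //; under eq_fun do rewrite norm2_sqr.
apply: measurable_sum => i; apply: measurable_funX.
under eq_fun do rewrite mxE; apply: measurable_sum => j.
apply: measurable_funM => //; under eq_fun do rewrite mxE; exact: measurable_funM.
Qed.

Lemma measurable_rho_near1 eps :
  measurable [set w | (1 - eps <= rho s (B w) <= 1 + eps)%R].
Proof.
rewrite [X in measurable X](_ : _ = (fun w => rho s (B w)) @^-1` `[1 - eps, 1 + eps]); last first.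
  by apply/seteqP; split=> w /=; rewrite in_itv.
by rewrite -[X in measurable X]setTI; exact: measurable_rho_scaled.
Qed.

Lemma rho_tail eps : 0 < eps ->
  19 * (72 / kappa) * (s * ln n%:R / eps ^+ 2) <= m%:R ->
  (P (~` [set w | (1 - eps <= rho s (B w) <= 1 + eps)%R])
    <= (expR (- (kappa / 72 * eps ^+ 2 * m%:R)))%:E)%E.
Proof.
move=> e0 hm; have k0 := kappa_gt0.
set G := [set w | _].
pose N := Num.truncn (6 * s).
(* Padding with [None] represents every list of length at most [N] by an [N]-tuple, so [(2 n + 1)^N]
   tuples index the net. *)
pose net (tau : N.-tuple (option ('I_n * bool))) := signed_sum R (pmap id tau).
pose t := dev_threshold eps.
pose bad tau := if net tau == 0 then set0 else [set w | t <= deviation (net tau) w]%R.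
have mbad tau : measurable (bad tau).
  rewrite /bad; case: ifP => // _.
  rewrite [X in measurable X](_ : _ = deviation (net tau) @^-1` `[t, +oo[); last first.
    by apply/seteqP; split=> x /=; rewrite in_itv/= andbT.
  by rewrite -[X in measurable X]setTI; exact: measurable_deviation.
have cover : ~` G `<=` \big[setU/set0]_tau bad tau.
  rewrite -[X in _ `<=` X]setCK; apply: subsetC => w hw.
  apply: rho_near1 => //; first exact: leq_trans n2.
  move=> l ls z0.
  have s60 : 0 <= 6 * s by apply: mulr_ge0 => //; exact: le_trans s1.
  have lN : (size l <= N)%N by rewrite /N truncn_ge_nat.
  have tauP : size (map Some l ++ nseq (N - size l) None) == N.
    by rewrite size_cat size_map size_nseq subnKC.
  have netE : net (Tuple tauP) = signed_sum R l.
    rewrite /net /= pmap_cat map_pK//; congr signed_sum.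
    by rewrite -[RHS]cats0; congr (_ ++ _); elim: (N - size l)%N.
  rewrite ltNge; apply/negP => ht; apply: hw.
  rewrite (bigD1 (Tuple tauP))//=; left; rewrite /bad netE (negbTE z0).
  exact: ht.
have t0 : 0 < t by rewrite /t /dev_threshold; case: ifP => _; rewrite ?divr_gt0 ?exprn_gt0.
(* The value [eps^2 / 36] is exactly [t^2] when [eps <= 1], and lies below both [t] and [t^2]
   otherwise. *)
have vt : eps ^+ 2 / 36 <= t.
  by rewrite /t /dev_threshold; case: ifPn => [?|]; [nra|rewrite -ltNge => ?; nra].
have vt2 : eps ^+ 2 / 36 <= t ^+ 2.
  rewrite /t /dev_threshold; case: ifPn => [?|]; [nra|rewrite -ltNge => ?].
  have : eps ^+ 2 <= (eps ^+ 2) ^+ 2 by rewrite -exprM ler_eXn2l ?ltW.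
  nra.
have v0 : 0 < eps ^+ 2 / 36 by rewrite divr_gt0 ?exprn_gt0.
pose b := 2 * expR (- (kappa * (eps ^+ 2 / 36) * m%:R)).
have badP tau : (P (bad tau) <= b%:E)%E.
  rewrite /bad; case: ifPn => [_|z0]; last exact: deviation_tail.
  by rewrite measure0 lee_fin mulr_ge0 ?expR_ge0.
have unionP : (P (\big[setU/set0]_tau bad tau) <=
    \sum_(tau : N.-tuple (option ('I_n * bool))) P (bad tau))%E.
  elim: (index_enum _) => [|tau r IH]; first by rewrite !big_nil measure0.
  rewrite !big_cons; apply: (le_trans (measureU2 _ (mbad tau) _)).
    by apply: bigsetU_measurable => ? _; exact: mbad.
  exact: leeD2l.
apply: (@le_trans _ _ (\sum_(tau : N.-tuple (option ('I_n * bool))) b%:E)%E).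
  apply: (@le_trans _ _ (P (\big[setU/set0]_tau bad tau))).
    apply: le_measure; rewrite ?inE//; first exact/measurableC/measurable_rho_near1.
    by apply: bigsetU_measurable => tau _; exact: mbad.
  by apply: (le_trans unionP); apply: lee_sum => tau _; exact: badP.
rewrite sumEFin sumr_const card_tuple card_option card_prod card_ord card_bool.
rewrite lee_fin -[leLHS]mulr_natr [(n * 2)%N]mulnC /b.
rewrite [leLHS](_ : _ = 2 * ((2 * n).+1 ^ N)%:R *
  expR (- (kappa * (eps ^+ 2 / 36) * m%:R))); last by rewrite mulrAC.
have hc := net_card_le n2 s1.
have := ler_wpM2r (expR_ge0 (- (kappa * (eps ^+ 2 / 36) * m%:R))) hc.
move=> /le_trans; apply.
rewrite -expRD ler_expR.
(* The tail exponent is twice [kappa / 72 * eps^2 * m]; the condition on [m] lets one half absorb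
   the size of the net. *)
have -> : 19 * (s * ln n%:R) = 19 * (72 / kappa) * (s * ln n%:R / eps ^+ 2) * (kappa / 72 * eps ^+ 2).
  by field; apply/andP; split; rewrite gt_eqF.
have := ler_wpM2r (_ : 0 <= kappa / 72 * eps ^+ 2) hm.
have h0 : 0 <= kappa / 72 * eps ^+ 2 by rewrite mulr_ge0 ?sqr_ge0//; lra.
move=> /(_ h0) h; lra.
Qed.

(** Slicing at the multiples of [eps]: the deviation is at most [eps] plus [eps] times the number of
    [k] with [E k], whose expectation is at most the sum 2 of the powers of one half. *)
Lemma rho_mean eps : 0 < eps ->
  19 * (72 / kappa) * (s * ln n%:R / eps ^+ 2) <= m%:R ->
  (\int[P]_w (`|1 - rho s (B w)|)%:E <= (3 * eps)%:E)%E.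
Proof.
move=> e0 hm; have k0 := kappa_gt0.
pose X w := `|1 - rho s (B w)|.
have mX : measurable_fun setT X.
  apply: measurableT_comp => //; apply: measurable_funB => //.
  exact: measurable_rho_scaled.
pose E (k : nat) := [set w | k%:R * eps < X w].
have mE k : measurable (E k).
  rewrite [X in measurable X](_ : _ = X @^-1` `]k%:R * eps, +oo[); last first.
    by apply/seteqP; split=> w /=; rewrite in_itv/= andbT.
  by rewrite -[X in measurable X]setTI; exact: mX.
have lnn : ln 2 <= ln n%:R :> R by rewrite ler_ln ?posrE ?ltr0n ?ler_nat// (leq_trans _ n2).
have ln2 : 0 < ln 2 :> R by rewrite ln_gt0// ltr1n.
(* Since [2 <= n] and [1 <= s], the condition on [m] already makes the tail bound at [eps] at most
   one half. *)
have decay : ln 2 <= kappa / 72 * eps ^+ 2 * m%:R.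
  have h0 : 0 <= kappa / 72 * eps ^+ 2 by rewrite mulr_ge0 ?sqr_ge0//; lra.
  apply: le_trans (ler_wpM2l h0 hm).
  have -> : kappa / 72 * eps ^+ 2 * (19 * (72 / kappa) * (s * ln n%:R / eps ^+ 2)) = 19 * (s * ln n%:R).
    by field; apply/andP; split; rewrite gt_eqF.
  have := ler_wpM2r (le_trans (ltW ln2) lnn) s1; rewrite mul1r; lra.
have PE k : (P (E k) <= (2 / (2 ^ k.+1)%:R)%:E)%E.
  have -> : 2 / (2 ^ k.+1)%:R = (2 ^ k)%:R^-1 :> R.
    by rewrite expnS natrM invfM mulrA divff ?mul1r.
  case: k => [|k]; first by rewrite expn0 invr1 probability_le1.
  have ke0 : 0 < k.+1%:R * eps by rewrite mulr_gt0.
  have -> : E k.+1 = ~` [set w | (1 - k.+1%:R * eps <= rho s (B w) <= 1 + k.+1%:R * eps)%R].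
    apply/seteqP; split=> w /=; rewrite /E /X /= ltNge ler_norml => h.
      by apply/negP; apply: contra h => /andP[? ?]; apply/andP; split; lra.
    by move/negP: h; apply: contra => /andP[? ?]; apply/andP; split; lra.
  apply: (le_trans (rho_tail ke0 _)).
    have c0 : 0 <= 19 * (72 / kappa) by apply: mulr_ge0 => //; apply: divr_ge0 => //; exact: ltW.
    apply: le_trans hm; apply: (ler_wpM2l c0); apply: ler_wpM2l.
      by apply: mulr_ge0; [exact: le_trans s1|exact: le_trans (ltW ln2) lnn].
    rewrite lef_pV2 ?posrE ?exprn_gt0// ler_sqr ?nnegrE ?(ltW e0) ?(ltW ke0)//.
    by rewrite ler_peMl ?(ltW e0)// ler1n.
  rewrite lee_fin expRN lef_pV2 ?posrE ?expR_gt0// ?ltr0n ?expn_gt0//.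
  have -> : (2 ^ k.+1)%:R = expR (k.+1%:R * ln 2) :> R.
    by rewrite expRM_natl lnK ?posrE// natrX.
  (* Level [k + 1] multiplies the exponent by [(k + 1)^2], of which a factor [k + 1] is enough for a
     geometric bound. *)
  have k2 : k.+1%:R <= k.+1%:R ^+ 2 :> R by rewrite -natrX ler_nat leq_pmull.
  rewrite ler_expR; apply: (le_trans (ler_pM _ (ltW ln2) k2 decay)) => //.
  by rewrite le_eqVlt; apply/orP; left; apply/eqP; move: (k.+1%:R) => K1; ring.
(* Every [k] below the integer part of [X w / eps] satisfies [k eps < X w], so all these indicators
   equal 1; the leading [eps] covers the fractional part. *)
have pt w : (X w <= eps + \sum_(0 <= k < Num.truncn (X w / eps)) eps * \1_(E k) w)%R.
  have q0 : 0 <= X w / eps by apply: divr_ge0; [exact: normr_ge0|exact: ltW].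
  have /andP[q1 q2] := truncn_itv q0.
  rewrite (_ : \sum_(0 <= k < _) _ = (Num.truncn (X w / eps))%:R * eps); last first.
    transitivity (\sum_(0 <= k < Num.truncn (X w / eps)) eps); last first.
      by rewrite sumr_const_nat subn0 mulr_natl.
    apply: eq_big_nat => k /= kq.
    rewrite indicE mem_set ?mulr1// /E /=.
    by rewrite -ltr_pdivlMr// (lt_le_trans _ q1)// ltr_nat.
  by move: q2; rewrite ltr_pdivrMr// -natr1 mulrDl mul1r addrC; exact: ltW.
have mEk k : measurable_fun setT (fun w => (eps * \1_(E k) w)%:E).
  by apply/measurable_EFinP; apply: measurable_funM => //; exact: measurable_indic.
have Ek0 k w : (0 <= (eps * \1_(E k) w)%:E)%E by rewrite lee_fin mulr_ge0// ltW.
apply: (@le_trans _ _ (\int[P]_w (eps%:E + \sum_(k <oo) (eps * \1_(E k) w)%:E))%E).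
  apply: ge0_le_integral => //.
  - exact/measurable_EFinP.
  - apply: emeasurable_funD => //; exact: ge0_emeasurable_sum.
  - move=> w _; apply: (@le_trans _ _ (eps%:E +
        \sum_(0 <= k < Num.truncn (X w / eps)) (eps * \1_(E k) w)%:E)%E).
      by rewrite sumEFin -EFinD lee_fin; exact: pt.
    by rewrite leeD2l// nneseries_lim_ge.
rewrite ge0_integralD//; last 3 first.
- by move=> w _; rewrite lee_fin ltW.
- by move=> w _; exact: nneseries_ge0.
- exact: ge0_emeasurable_sum.
rewrite integral_cst// [X in (_ * X)%E]probability_setT mule1 integral_nneseries//.
have -> : 3 * eps = eps + 2 * eps by lra.
rewrite EFinD leeD2l//.
apply: (le_trans _ (@epsilon_trick0 R (2 * eps) xpredT _)); last by rewrite mulr_ge0 ?ltW.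
apply: lee_nneseries => [k _ _|k _]; first exact: integral_ge0.
under eq_integral do rewrite EFinM.
rewrite ge0_integralZl//; do ?[by rewrite lee_fin ltW |
  by apply/measurable_EFinP; exact: measurable_indic].
rewrite integral_indic// setIT; apply: (le_trans (lee_wpmul2l _ (PE k))).
  by rewrite lee_fin ltW.
by rewrite -EFinM lee_fin; lra.
Qed.

End tail.

Theorem theorem3 (R : realType) (L : R) (L_gt0 : 0 < L) :
  exists c1 c2 c3 : R, [/\ 0 < c1, 0 < c2, 0 < c3 &
    forall (n m : nat) (s : R) (d : measure_display) (T : measurableType d)
           (P : probability T R) (A : T -> 'M[R]_(m, n)),
      (2 <= n)%N -> (1 <= m)%N -> 1 <= s <= n%:R ->
      (forall i : 'I_m, random_vector (fun w => row i (A w))) ->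
      mutually_independent P (fun (i : 'I_m) w => row i (A w)) ->
      identically_distributed P (fun (i : 'I_m) w => row i (A w)) ->
      (forall i : 'I_m, isotropic P (fun w => row i (A w))) ->
      (forall i : 'I_m, subgaussian P L (fun w => row i (A w))) ->
      forall eps : R, 0 < eps ->
        c1 * (s * ln n%:R / eps ^+ 2) <= m%:R ->
        ('E_P[(fun w => `|1 - rho s ((Num.sqrt m%:R)^-1 *: A w)|%R)]
           <= (c2 * eps)%:E)%E
        /\
        ((1 - expR (- (c3 * eps ^+ 2 * m%:R)))%:E
           <= P [set w | (1 - eps <= rho s ((Num.sqrt m%:R)^-1 *: A w)
                            <= 1 + eps)%R])%E ].
Proof.
set kappa := bernstein_rate (4 * L ^+ 2).
have k0 : 0 < kappa.
  by apply: bernstein_rate_gt0; apply: mulr_gt0 => //; exact: exprn_gt0.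
(* The third constant is half of the rate [kappa / 36] at one vector of the net; the first is 19,
   from the size of the net, divided by the third. *)
exists (19 * (72 / kappa)), 3, (kappa / 72); split => //.
- by apply: mulr_gt0 => //; exact: divr_gt0.
- exact: divr_gt0.
move=> n m s d T P A n2 m1 /andP[s1 _] mA indA _ isoA subA eps e0 hm; split.
  by rewrite unlock; exact: (rho_mean L_gt0 n2 m1 s1 mA indA isoA subA e0 hm).
have mG := @measurable_rho_near1 R n m s d T A n2 s1 mA eps.
have := rho_tail L_gt0 n2 m1 s1 mA indA isoA subA e0 hm.
rewrite probability_setC// => h.
rewrite EFinB leeBlDr// addeC -leeBlDr//.
exact: fin_num_measure.
Qed.
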